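(* Let $X,Y\in \operatorname{skew}(p)\times\mathbb{R}^{(n-p)\times p}$. If $\|X-Y\|_F<\tfrac{2}{3}$, then $$\operatorname{dist}_E(\varphi_E(X),\varphi_E(Y))\le 2\arcsin\left(\tfrac{3}{2}\|X-Y\|_F\right).$$
   Context: Let $p\le n$ be positive integers. $\operatorname{St}(n,p)=\{U\in\mathbb{R}^{n\times p}: U^TU=I_p\}$ is the Stiefel manifold and $\operatorname{skew}(p)$ is the space of real skew-symmetric $p\times p$ matrices. An element of $\operatorname{skew}(p)\times\mathbb{R}^{(n-p)\times p}$ is written as a stacked $n\times p$ matrix $X=\begin{bmatrix} A \\ B \end{bmatrix}$ with $A\in\operatorname{skew}(p)$, $B\in\mathbb{R}^{(n-p)\times p}$, and $\|\cdot\|_F$ is the Frobenius norm. The polar-light parametrization centered at $E=\begin{bmatrix} I_p \\ 0 \end{bmatrix}\in\operatorname{St}(n,p)$ is $$\varphi_E\left(\begin{bmatrix} A \\ B \end{bmatrix}\right)=\begin{bmatrix} \exp_m(A) \\ B \end{bmatrix}(I_p+B^TB)^{-1/2}\in\operatorname{St}(n,p),$$ where $\exp_m$ is the matrix exponential. $\operatorname{dist}_E$ is the Riemannian distance on $\operatorname{St}(n,p)$ for the Euclidean metric $g_e(\xi,\Delta)=\operatorname{tr}(\xi^T\Delta)$ on each tangent space $T_U\operatorname{St}(n,p)=\{\xi\in\mathbb{R}^{n\times p}:U^T\xi+\xi^TU=0\}$. *)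

(* Defs.v *)
From HB Require Import structures.
From mathcomp Require Import all_boot all_order all_algebra.
From mathcomp Require Import all_classical all_reals all_analysis.

Set Implicit Arguments.
Unset Strict Implicit.
Unset Printing Implicit Defensive.

Import Order.TTheory GRing.Theory Num.Theory.
Import numFieldNormedType.Exports.

Local Open Scope classical_set_scope.
Local Open Scope ring_scope.

Definition stiefel (R : realType) (n p : nat) : set 'M[R]_(n, p) :=
  [set U | U^T *m U = 1%:M].

(* The velocity of a curve in [stiefel n p] automatically satisfies the tangent
   space equation U^T xi + xi^T U = 0, so the Riemannian metric is represented
   by the ambient trace form of which it is the restriction. *)
Definition euclidean_metric (R : realType) (n p : nat)
    (xi delta : 'M[R]_(n, p)) : R := \tr (xi^T *m delta).

Definition frobenius_norm (R : realType) (n p : nat) (M : 'M[R]_(n, p)) : R :=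
  Num.sqrt (\sum_(i < n) \sum_(j < p) M i j ^+ 2).

Definition C1 (R : realType) (V : normedModType R) (f : R -> V) : Prop :=
  (forall t, derivable f t 1) /\ continuous (derive1 f).

(* The points of [s] subdivide [a, b].  Being C^1 up to the end points of a
   nondegenerate closed interval is being the restriction of a C^1 function
   defined on the whole line; adjacent pieces share an end point, so [c] is
   continuous on [a, b]. *)
Definition piecewise_C1 (R : realType) (V : normedModType R)
    (c : R -> V) (a b : R) : Prop :=
  exists s : seq R, path <%R a (rcons s b) /\
    forall i, (i <= size s)%N ->
      exists h : R -> V, C1 h /\
        {in `[(a :: rcons s b)`_i, (a :: rcons s b)`_i.+1], c =1 h}.

(* At the finitely many break points the value of [derive1 c] is irrelevant, being
   on a set of measure zero. *)
Definition curve_length (R : realType) (n p : nat) (c : R -> 'M[R]_(n, p)) :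
    \bar R :=
  (\int[lebesgue_measure]_(t in `[0%R, 1%R])
     (Num.sqrt (euclidean_metric (derive1 c t) (derive1 c t)))%:E)%E.

(* Extended-real valued: the distance is +oo when no curve joins U to V (for
   n = p the manifold is the orthogonal group, which is disconnected). *)
Definition stiefel_dist (R : realType) (n p : nat) (U V : 'M[R]_(n, p)) :
    \bar R :=
  ereal_inf [set curve_length c | c in
    [set c : R -> 'M[R]_(n, p) |
      [/\ piecewise_C1 c 0 1,
          (forall t, t \in `[0, 1] -> stiefel (c t)),
          c 0 = U & c 1 = V]]].

Definition expmx (R : realType) (p : nat) (A : 'M[R]_p) : 'M[R]_p :=
  lim (series (fun k : nat => (k`!%:R)^-1 *: A ^+ k) @ \oo).

Definition psdmx (R : realType) (p : nat) (S : 'M[R]_p) : Prop :=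
  S^T = S /\ forall x : 'cV[R]_p, 0 <= (x^T *m S *m x) 0 0.

(* The principal square root: a positive semidefinite matrix has exactly one
   positive semidefinite square root.  The default value 0 is never used on
   such a matrix. *)
Definition sqrtmx (R : realType) (p : nat) (M : 'M[R]_p) : 'M[R]_p :=
  xget 0 [set S | psdmx S /\ S *m S = M].

(* [q] stands for n - p, and [X] is the stacked matrix with A = usubmx X and
   B = dsubmx X. *)
Definition polar_light (R : realType) (p q : nat) (X : 'M[R]_(p + q, p)) :
    'M[R]_(p + q, p) :=
  col_mx (expmx (usubmx X)) (dsubmx X)
    *m invmx (sqrtmx (1%:M + (dsubmx X)^T *m dsubmx X)).

(* skew(p) x R^(q x p), as a set of stacked matrices. *)
Definition skew_stack (R : realType) (p q : nat) : set 'M[R]_(p + q, p) :=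
  [set X | (usubmx X)^T = - usubmx X].

(* Main.v *)
Require Import Defs.
From HB Require Import structures.
From mathcomp Require Import all_boot all_order all_algebra.
From mathcomp Require Import all_classical all_reals all_analysis.
From mathcomp Require Import measurable_realfun ring lra.
Import Order.TTheory GRing.Theory Num.Theory.
Import numFieldNormedType.Exports.
Local Open Scope ring_scope.

(* The point phi_E(X) is the polar factor c of W = [exp A; B]: one has W = c S
   with S >= 1.  On matrices with S >= 1 the polar factor is 1-Lipschitz, and
   exp is 1-Lipschitz on skew matrices, whence
   |phi_E(X) - phi_E(Y)| <= |X - Y|.  Two points U, V of the Stiefel manifold
   with |V - U| < 2/3 are joined by the curve (1 - tZ)^-1 (1 + tZ) U for a skew
   matrix Z such that Z (U + V) = V - U, and Z can be chosen so that the length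
   of this curve is at most 3 |V - U|.  Finally 3 d <= 2 arcsin (3 d / 2). *)

(** The distance is an infimum over curves, so one explicit curve of controlled length suffices, and
    as 2 arcsin (3 d / 2) >= 3 d that length may exceed the chord by a factor 3. The Cayley curve is
    rational in t, stays on the manifold as soon as Z is skew, and has speed at most 2 |Z| because
    the resolvent of a skew matrix contracts. What remains is to control the size of Z. The equation
    Z (U + V) = V - U has a skew solution once U + V has full column rank, and the identity (U +
    V)^T (U + V) = 4 - (V - U)^T (V - U) turns |V - U| < 2/3 into a quantitative form of this rank
    condition. Regarding phi_E as a polar factor avoids differentiating the inverse square root: its
    Lipschitz bound becomes a trace inequality. The square root itself comes from a fixed-point
    iteration, without diagonalization. *)

Local Notation dot := (@euclidean_metric _ _ _).
Local Notation frob := (@frobenius_norm _ _ _).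

(** * Trace inner product, positive semidefinite forms, polar factors *)

Section TraceForm.
Context {R : realType}.

Lemma dotE {m n : nat} (X Y : 'M[R]_(m, n)) :
  dot X Y = \sum_(i < m) \sum_(j < n) X i j * Y i j.
Proof.
rewrite /euclidean_metric /mxtrace exchange_big; apply: eq_bigr => j _.
by rewrite mxE; apply: eq_bigr => i _; rewrite mxE.
Qed.

Lemma dotC {m n : nat} (X Y : 'M[R]_(m, n)) : dot X Y = dot Y X.
Proof. by rewrite !dotE; do 2![apply: eq_bigr => ? _]; rewrite mulrC. Qed.

Lemma dotDr {m n : nat} (X Y Z : 'M[R]_(m, n)) :
  dot X (Y + Z) = dot X Y + dot X Z.
Proof. by rewrite /euclidean_metric mulmxDr mxtraceD. Qed.

Lemma dotZr {m n : nat} (a : R) (X Y : 'M[R]_(m, n)) :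
  dot X (a *: Y) = a * dot X Y.
Proof. by rewrite /euclidean_metric -scalemxAr mxtraceZ. Qed.

Lemma dotNr {m n : nat} (X Y : 'M[R]_(m, n)) : dot X (- Y) = - dot X Y.
Proof. by rewrite -scaleN1r dotZr mulN1r. Qed.

Lemma dotBr {m n : nat} (X Y Z : 'M[R]_(m, n)) :
  dot X (Y - Z) = dot X Y - dot X Z.
Proof. by rewrite dotDr dotNr. Qed.

Lemma dotDl {m n : nat} (X Y Z : 'M[R]_(m, n)) :
  dot (X + Y) Z = dot X Z + dot Y Z.
Proof. by rewrite dotC dotDr !(dotC Z). Qed.

Lemma dotZl {m n : nat} (a : R) (X Y : 'M[R]_(m, n)) :
  dot (a *: X) Y = a * dot X Y.
Proof. by rewrite dotC dotZr dotC. Qed.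

Lemma dotNl {m n : nat} (X Y : 'M[R]_(m, n)) : dot (- X) Y = - dot X Y.
Proof. by rewrite dotC dotNr dotC. Qed.

Lemma dotBl {m n : nat} (X Y Z : 'M[R]_(m, n)) :
  dot (X - Y) Z = dot X Z - dot Y Z.
Proof. by rewrite dotDl dotNl. Qed.

Lemma dot_ge0 {m n : nat} (X : 'M[R]_(m, n)) : 0 <= dot X X.
Proof.
by rewrite dotE; do 2![apply: sumr_ge0 => ? _]; rewrite -expr2 sqr_ge0.
Qed.

Lemma sqr_coord_le_dot {m n : nat} (X : 'M[R]_(m, n)) i j :
  X i j ^+ 2 <= dot X X.
Proof.
rewrite dotE (bigD1 i)//= (bigD1 j)//= -expr2 -addrA lerDl addr_ge0//.
  by apply: sumr_ge0 => k _; rewrite -expr2 sqr_ge0.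
by do 2![apply: sumr_ge0 => ? _]; rewrite -expr2 sqr_ge0.
Qed.

Lemma dot_eq0 {m n : nat} (X : 'M[R]_(m, n)) : dot X X = 0 -> X = 0.
Proof.
move=> X0; apply/matrixP => i j; rewrite mxE; apply/eqP.
by rewrite -sqrf_eq0 eq_le sqr_ge0 andbT -X0 sqr_coord_le_dot.
Qed.

Lemma dot_trmx {m n : nat} (X Y : 'M[R]_(m, n)) : dot X^T Y^T = dot X Y.
Proof.
rewrite !dotE exchange_big; do 2![apply: eq_bigr => ? _].
by rewrite !mxE.
Qed.

Lemma dot_mulmxl {m n k : nat} (A : 'M[R]_(m, n)) X (Y : 'M[R]_(m, k)) :
  dot (A *m X) Y = dot X (A^T *m Y).
Proof. by rewrite /euclidean_metric trmx_mul mulmxA. Qed.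

Lemma dot_mulmxr {m n k : nat} X (A : 'M[R]_(n, k)) (Y : 'M[R]_(m, k)) :
  dot (X *m A) Y = dot X (Y *m A^T).
Proof.
by rewrite -dot_trmx trmx_mul dot_mulmxl -[LHS]dot_trmx trmx_mul !trmxK.
Qed.

Lemma frob_ge0 {m n : nat} (X : 'M[R]_(m, n)) : 0 <= frob X.
Proof. exact: sqrtr_ge0. Qed.

Lemma frobE {m n : nat} (X : 'M[R]_(m, n)) : frob X = Num.sqrt (dot X X).
Proof. by rewrite /frobenius_norm dotE. Qed.

Lemma sqr_frob {m n : nat} (X : 'M[R]_(m, n)) : frob X ^+ 2 = dot X X.
Proof. by rewrite frobE sqr_sqrtr// dot_ge0. Qed.

Lemma frob_le {m n : nat} (X : 'M[R]_(m, n)) (a : R) :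
  0 <= a -> (frob X <= a) = (dot X X <= a ^+ 2).
Proof. by move=> a0; rewrite -sqr_frob ler_sqr// nnegrE// frob_ge0. Qed.

Lemma frob0 {m n : nat} : frob (0 : 'M[R]_(m, n)) = 0.
Proof. by rewrite frobE -(scale0r (0 : 'M[R]_(m, n))) dotZr mul0r sqrtr0. Qed.

Lemma frob_le0 {m n : nat} (X : 'M[R]_(m, n)) : frob X <= 0 -> X = 0.
Proof.
move=> X0; apply: dot_eq0; rewrite -sqr_frob.
by rewrite (_ : frob X = 0) ?expr0n//; apply/eqP; rewrite eq_le X0 frob_ge0.
Qed.

Lemma frob_trmx {m n : nat} (X : 'M[R]_(m, n)) : frob X^T = frob X.
Proof. by rewrite !frobE dot_trmx. Qed.

Lemma frobZ {m n : nat} (a : R) (X : 'M[R]_(m, n)) :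
  frob (a *: X) = `|a| * frob X.
Proof.
by rewrite !frobE dotZl dotZr mulrA -expr2 sqrtrM ?sqr_ge0// sqrtr_sqr.
Qed.

Lemma frobN {m n : nat} (X : 'M[R]_(m, n)) : frob (- X) = frob X.
Proof. by rewrite !frobE dotNl dotNr opprK. Qed.

Lemma psd_dot {p k : nat} {S : 'M[R]_p} (X : 'M[R]_(p, k)) :
  psdmx S -> 0 <= dot X (S *m X).
Proof.
move=> [_ S0]; rewrite /euclidean_metric /mxtrace; apply: sumr_ge0 => j _.
have := S0 (col j X); congr (_ <= _).
rewrite -mulmxA !mxE; apply: eq_bigr => i _; rewrite !mxE; congr (_ * _).
by apply: eq_bigr => l _; rewrite !mxE.
Qed.

Lemma psdmx1 {p : nat} : psdmx (1%:M : 'M[R]_p).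
Proof.
split=> [|x]; first exact: trmx1.
by rewrite mulmx1 mxE sumr_ge0// => i _; rewrite mxE -expr2 sqr_ge0.
Qed.

Lemma psd_cauchy_schwarz {p k : nat} {S : 'M[R]_p} (X Y : 'M[R]_(p, k)) :
  psdmx S -> dot X (S *m Y) ^+ 2 <= dot X (S *m X) * dot Y (S *m Y).
Proof.
move=> Sp; have [ST _] := Sp.
have YX : dot Y (S *m X) = dot X (S *m Y) by rewrite dotC dot_mulmxl ST.
have quad (s t : R) : 0 <= s ^+ 2 * dot X (S *m X)
    + 2 * s * t * dot X (S *m Y) + t ^+ 2 * dot Y (S *m Y).
  have := psd_dot (s *: X + t *: Y) Sp.
  rewrite mulmxDr -!scalemxAr !(dotDl, dotDr, dotZl, dotZr) YX.
  by congr (_ <= _); ring.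
have a0 := psd_dot X Sp; have c0 := psd_dot Y Sp.
move: (dot X (S *m X)) (dot X (S *m Y)) (dot Y (S *m Y)) quad a0 c0.
move=> a b c quad a0 c0; have [c_gt0|c_le0] := ltP 0 c.
  (* The form at (s, t) = (c, -b) has the value c (a c - b^2). *)
  rewrite -subr_ge0 -(pmulr_rge0 _ c_gt0).
  by have := quad c (- b); congr (_ <= _); ring.
have {c_le0} c_eq0 : c = 0 by apply/eqP; rewrite eq_le c_le0 c0.
rewrite {}c_eq0 in quad c0 *.
(* With c = 0 the form takes the value -b^2 (a + 2) here, which forces b = 0. *)
have := quad b (- (a + 1)).
have := mulr_ge0 (sqr_ge0 b) a0; have := sqr_ge0 b; lra.
Qed.

Lemma dot_cauchy_schwarz {m n : nat} (X Y : 'M[R]_(m, n)) :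
  dot X Y <= frob X * frob Y.
Proof.
have := psd_cauchy_schwarz X Y psdmx1; rewrite !mul1mx -!sqr_frob -exprMn.
rewrite -ler_sqrt ?sqr_ge0// !sqrtr_sqr (ger0_norm (mulr_ge0 _ _)) ?frob_ge0//.
exact/le_trans/ler_norm.
Qed.

Lemma frob_triangle {m n : nat} (X Y : 'M[R]_(m, n)) :
  frob (X + Y) <= frob X + frob Y.
Proof.
rewrite frob_le ?addr_ge0 ?frob_ge0// !(dotDl, dotDr) (dotC Y) sqrrD !sqr_frob.
have := dot_cauchy_schwarz X Y; lra.
Qed.

Lemma coord_le_frob {m n : nat} (X : 'M[R]_(m, n)) i j : `|X i j| <= frob X.
Proof.
by rewrite frobE -sqrtr_sqr ler_sqrt ?dot_ge0// sqr_coord_le_dot.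
Qed.

Lemma frob_le_of_sqr {m n k l : nat} (X : 'M[R]_(m, n)) (Y : 'M[R]_(k, l)) :
  dot X X <= dot Y Y -> frob X <= frob Y.
Proof. by move=> h; rewrite frob_le ?frob_ge0// sqr_frob. Qed.

Lemma frob_mulmx_orthl {m n k : nat} (Q : 'M[R]_(m, n)) (X : 'M[R]_(n, k)) :
  Q^T *m Q = 1%:M -> frob (Q *m X) = frob X.
Proof. by move=> QQ; rewrite !frobE dot_mulmxl mulmxA QQ mul1mx. Qed.

Lemma frob_mulmx_orthr {m n k : nat} (X : 'M[R]_(m, n)) (Q : 'M[R]_(n, k)) :
  Q *m Q^T = 1%:M -> frob (X *m Q) = frob X.
Proof.
move=> QQ; rewrite -frob_trmx trmx_mul frob_mulmx_orthl ?trmxK//.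
exact: frob_trmx.
Qed.

Lemma inj_col_unitmx {p : nat} (S : 'M[R]_p) :
  (forall x : 'cV[R]_p, S *m x = 0 -> x = 0) -> S \in unitmx.
Proof.
move=> S0; rewrite -unitmx_tr -row_free_unit; apply/inj_row_free => v vS.
apply: trmx_inj; rewrite trmx0; apply: S0.
by rewrite -[S]trmxK -trmx_mul vS trmx0.
Qed.

(* Cauchy-Schwarz for the form S, applied to X and S^-1 X. *)
Lemma psd_sqr_ge1 {p : nat} (S N : 'M[R]_p) :
  psdmx S -> psdmx N -> S *m S = 1%:M + N ->
  S \in unitmx /\
  forall k (X : 'M[R]_(p, k)), dot X X <= dot X (S *m X).
Proof.
move=> Sp Np SS; have [ST _] := Sp.
have expand k (X : 'M[R]_(p, k)) : dot X X <= dot (S *m X) (S *m X).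
  rewrite dot_mulmxl ST mulmxA SS mulmxDl mul1mx dotDr lerDl.
  exact: psd_dot.
have Su : S \in unitmx.
  apply: inj_col_unitmx => x Sx; apply: dot_eq0; apply/eqP.
  rewrite eq_le dot_ge0 andbT (le_trans (expand _ _))// Sx.
  by rewrite -(scale0r (0 : 'cV[R]_p)) dotZr mul0r.
split=> // k X; set Y := invmx S *m X.
have SY : S *m Y = X by rewrite mulmxA mulmxV// mul1mx.
have := psd_cauchy_schwarz X Y Sp; rewrite SY.
(* [S] expands norms, so [Y] is no longer than [X]; Cauchy-Schwarz then reads <X, X>^2 <= <X, S X>
   <Y, X> <= <X, S X> <X, X>. *)
have YX : dot Y X <= dot X X.
  apply: (le_trans (dot_cauchy_schwarz _ _)).
  rewrite -[leRHS]sqr_frob expr2 ler_wpM2r ?frob_ge0//.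
  by apply: frob_le_of_sqr; rewrite (le_trans (expand _ _))// SY.
have X0 := dot_ge0 X; have XS0 := psd_dot X Sp.
have [X_gt0|] := ltP 0 (dot X X); last by move/le_trans => h _; exact: h.
have := ler_wpM2l XS0 YX => h1 h2.
by rewrite -(ler_pM2r X_gt0) -expr2 (le_trans h2).
Qed.

Lemma psd_trace_mul {m p : nat} (S : 'M[R]_p) (D : 'M[R]_(m, p)) :
  psdmx S -> 0 <= \tr (S *m (D^T *m D)).
Proof.
by move=> /(psd_dot D^T); rewrite /euclidean_metric trmxK mxtrace_mulC -!mulmxA.
Qed.

(* With D = c1 - c0, the excess of <D, c1 S1 - c0 S0> over <D, D> is
   tr ((S1 - 1) + (S0 - 1)) D^T D / 2. *)
Lemma polar_factor_lipschitz {m p : nat} (c0 c1 : 'M[R]_(m, p))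
    (S0 S1 : 'M[R]_p) :
  c0^T *m c0 = 1%:M -> c1^T *m c1 = 1%:M ->
  psdmx (S0 - 1%:M) -> psdmx (S1 - 1%:M) ->
  frob (c1 - c0) <= frob (c1 *m S1 - c0 *m S0).
Proof.
move=> c00 c11 P0 P1; set D := c1 - c0; set W := _ - c0 *m S0.
suff DW : dot D D <= dot D W.
  have := le_trans DW (dot_cauchy_schwarz D W); rewrite -sqr_frob expr2.
  have [D0|] := ltP 0 (frob D); first by rewrite ler_pM2l.
  by move/le_trans => h _; apply/h/frob_ge0.
have tr1 := psd_trace_mul _ D P1; have tr0 := psd_trace_mul _ D P0.
have DD : D^T *m D = 1%:M + 1%:M - c1^T *m c0 - c0^T *m c1.
  rewrite /D [(_ - _)^T]linearB/= mulmxBl !mulmxBr c00 c11.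
  rewrite opprB addrACA -!addrA.
  by congr (_ + _); rewrite addrCA; congr (_ + _); rewrite addrC.
(* Against a symmetric [P], [c1^T c0] and its transpose have the same trace, so the two cross terms
   of [D^T D] count equally; hence the division by 2 below. *)
have trC (P G : 'M[R]_p) : psdmx P -> \tr (P *m G^T) = \tr (P *m G).
  by move=> [PT _]; rewrite -mxtrace_tr trmx_mul trmxK PT mxtrace_mulC.
have De1 P : psdmx P -> dot D (c1 *m P) = \tr (P *m (D^T *m D)) / 2.
  move=> /trC trP; rewrite /euclidean_metric mulmxA mxtrace_mulC DD.
  rewrite /D [(_ - _)^T]linearB/= mulmxBl c11.
  rewrite !(mulmxDr, mulmxN, mxtraceD, raddfN)/=.
  by rewrite -(trP (c1^T *m c0)) trmx_mul trmxK; field.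
have De0 P : psdmx P -> dot D (c0 *m P) = - \tr (P *m (D^T *m D)) / 2.
  move=> /trC trP; rewrite /euclidean_metric mulmxA mxtrace_mulC DD.
  rewrite /D [(_ - _)^T]linearB/= mulmxBl c00.
  rewrite !(mulmxDr, mulmxN, mxtraceD, raddfN)/=.
  by rewrite -(trP (c1^T *m c0)) trmx_mul trmxK; field.
have -> : W = D + c1 *m (S1 - 1%:M) - c0 *m (S0 - 1%:M).
  rewrite !mulmxBr !mulmx1 /W /D; move: (c1 *m S1) (c0 *m S0) => a b.
  by apply/matrixP => i j; rewrite !mxE; ring.
rewrite [leRHS]dotBr [dot D (D + _)]dotDr De1// De0//.
by move: tr1 tr0; lra.
Qed.

End TraceForm.

(** * A small skew generator whose Cayley transform maps U to V *)

Section CayleyGenerator.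
Context {R : realType}.

Lemma frob_mulmx {m n k : nat} (X : 'M[R]_(m, n)) (Y : 'M[R]_(n, k)) :
  frob (X *m Y) <= frob X * frob Y.
Proof.
rewrite frob_le ?mulr_ge0 ?frob_ge0// exprMn !sqr_frob.
have dot_rows a b (Z : 'M[R]_(a, b)) :
    dot Z Z = \sum_(i < a) dot (row i Z)^T (row i Z)^T.
  rewrite dotE; apply: eq_bigr => i _; rewrite dot_trmx dotE big_ord1.
  by apply: eq_bigr => j _; rewrite !mxE.
rewrite dotE (dot_rows _ _ X) -(dot_trmx Y) (dot_rows _ _ Y^T) mulr_suml.
apply: ler_sum => i _; rewrite mulr_sumr; apply: ler_sum => j _.
rewrite -expr2.
have -> : (X *m Y) i j = dot (row i X)^T (row j Y^T)^T.
  rewrite dot_trmx dotE big_ord1 mxE.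
  by apply: eq_bigr => l _; rewrite !mxE.
have := psd_cauchy_schwarz (row i X)^T (row j Y^T)^T psdmx1.
by rewrite !mul1mx.
Qed.

(* The skew matrix W solves W (U + V) = 2 (V - U), so that its Cayley transform
   maps U to V.  With M = U + V, D = V - U, G = (M^T M)^-1 and P = M G M^T the
   orthogonal projection on the range of M, W is (1 - P) N - N^T for
   N = 2 D G M^T. *)
Lemma cayley_generator {m p : nat} (U V : 'M[R]_(m, p)) :
  stiefel U -> stiefel V -> frob (V - U) < 2 / 3 ->
  exists W : 'M[R]_m, [/\ W^T = - W, W *m (U + V) = 2 *: (V - U) &
    frob W <= 3 * frob (V - U)].
Proof.
rewrite /stiefel/= => UU VV; set D := V - U; set M := U + V => D_lt.
have DTE : D^T = V^T - U^T by rewrite /D linearB.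
have MTE : M^T = U^T + V^T by rewrite /M linearD.
set H := M^T *m M.
(* Parallelogram identity: M^T M + D^T D = 2 (U^T U + V^T V) = 4. *)
have HE : H = 4%:R%:M - D^T *m D.
  rewrite /H MTE DTE /M /D.
  rewrite !(mulmxDl, mulmxDr, mulmxBl, mulmxBr, mulmxN, mulNmx) UU VV.
  move: (U^T *m V) (V^T *m U) => a b.
  by apply/matrixP => i j; rewrite !mxE; case: eqP => _ /=; ring.
have HT : H^T = H by rewrite /H trmx_mul trmxK.
have DD : dot D D < 4 / 9.
  by rewrite -sqr_frob; have := frob_ge0 D; nra.
(* The smallest eigenvalue of [H] is at least 4 - 4/9, rounded down to 3. *)
have H_ge k (Y : 'M[R]_(k, p)) : 3 * dot Y Y <= dot Y (Y *m H).
  rewrite HE mulmxBr mul_mx_scalar dotBr dotZr.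
  have -> : dot Y (Y *m (D^T *m D)) = dot (Y *m D^T) (Y *m D^T).
    by rewrite dot_mulmxr trmxK mulmxA.
  have : frob (Y *m D^T) ^+ 2 <= (frob Y * frob D) ^+ 2.
    by rewrite ler_sqr ?nnegrE ?mulr_ge0 ?frob_ge0// -(frob_trmx D) frob_mulmx.
  rewrite exprMn !sqr_frob; have := dot_ge0 Y; nra.
have Hu : H \in unitmx.
  apply: inj_col_unitmx => x Hx; apply: dot_eq0.
  have := H_ge _ x^T; rewrite -[H]HT -trmx_mul Hx !dot_trmx.
  have -> : dot x 0 = 0 by rewrite -(scale0r (0 : 'cV[R]_p)) dotZr mul0r.
  have := dot_ge0 x; lra.
set G := invmx H; have GH : G *m H = 1%:M by rewrite mulVmx.
have HG : H *m G = 1%:M by rewrite mulmxV.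
have GT : G^T = G by rewrite /G trmx_inv HT.
set P := M *m G *m M^T; set N := 2 *: (D *m G *m M^T).
have PT : P^T = P by rewrite /P !trmx_mul trmxK GT mulmxA.
have PP : P *m P = P.
  by rewrite /P -!mulmxA (mulmxA M^T) -/H (mulmxA H) HG mul1mx.
have NM : N *m M = 2 *: D.
  by rewrite /N -scalemxAl -!mulmxA -/H GH mulmx1.
(* M^T D is skew because U^T U = V^T V. This makes P N skew, hence W skew, and cancels the last two
   terms of W M = 2 D - 2 M G (M^T D + D^T M). *)
have skewK : M^T *m D + D^T *m M = 0.
  rewrite MTE DTE /M /D.
  rewrite !(mulmxDl, mulmxDr, mulmxBl, mulmxBr, mulmxN, mulNmx) UU VV.
  move: (U^T *m V) (V^T *m U) => a b.
  by apply/matrixP => i j; rewrite !mxE; ring.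
have PN : P *m N = 2 *: (M *m G *m (M^T *m D) *m G *m M^T).
  by rewrite /P /N -scalemxAr !mulmxA.
have NTE : N^T = 2 *: (M *m G *m D^T).
  by rewrite /N linearZ/= !trmx_mul trmxK GT mulmxA.
have NTP : N^T *m P = - (P *m N).
  have DM : D^T *m M = - (M^T *m D).
    by apply/eqP; rewrite -addr_eq0 addrC skewK.
  rewrite PN NTE /P -scalemxAl -scalerN; congr (_ *: _).
  by rewrite !mulmxA -(mulmxA _ D^T M) DM mulmxN !mulNmx !mulmxA.
set Q := (1%:M - P) *m N.
have QE : Q = N - P *m N by rewrite /Q mulmxBl mul1mx.
exists (Q - N^T); split.
- rewrite linearB/= trmxK QE linearB/= trmx_mul PT NTP.
  by move: (P *m N) N^T => a b; apply/matrixP => i j; rewrite !mxE; ring.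
- rewrite mulmxBl QE mulmxBl -(mulmxA P) NM NTE /P.
  rewrite -scalemxAl -!mulmxA -!scalemxAr.
  by rewrite -addrA -opprD -scalerDr -!mulmxDr skewK !mulmx0 scaler0 subr0.
(* Since [P] is an orthogonal projection, |N - P N|^2 = |N|^2 - |P N|^2. *)
have QN : frob Q <= frob N.
  apply: frob_le_of_sqr; rewrite QE !(dotBl, dotBr).
  have PNN : dot (P *m N) (P *m N) = dot N (P *m N).
    by rewrite dot_mulmxl PT mulmxA PP.
  by have := dot_ge0 (P *m N); rewrite (dotC (P *m N) N) PNN; lra.
(* In fact |N|^2 = 4 <D G, D> <= (4/3) |D|^2, and 4/3 <= (3/2)^2. The contributions of [Q] and [N^T]
   then add up to the constant 3. *)
have ND : frob N <= 3 / 2 * frob D.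
  rewrite frob_le ?mulr_ge0 ?frob_ge0//.
  rewrite /N dotZl dotZr dot_mulmxr trmxK -(mulmxA _ _ M) -/H -(mulmxA D) GH.
  rewrite mulmx1; set Y := D *m G.
  have YH : Y *m H = D by rewrite /Y -mulmxA GH mulmx1.
  have := H_ge _ Y; rewrite YH => h1; have h2 := dot_cauchy_schwarz Y D.
  rewrite exprMn; rewrite -sqr_frob in h1.
  have := frob_ge0 Y; have := frob_ge0 D.
  move: (frob Y) (frob D) (dot Y D) h1 h2 => y d e h1 h2 d0 y0.
  have [y_gt0|y_le0] := ltP 0 y; last by nra.
  have yd : 3 * y <= d by rewrite -(ler_pM2l y_gt0); lra.
  nra.
have := frob_triangle Q (- N^T); rewrite frobN frob_trmx; lra.
Qed.

End CayleyGenerator.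

(** * Entrywise limits and derivatives of matrix functions *)

Section MatrixCalculus.
Context {R : realType}.
Local Open Scope classical_set_scope.

(** The topology of matrices is that of the largest entry, not of [frob]; limits are therefore
    handled entry by entry, and [coord_le_frob] transfers Frobenius estimates. *)
Lemma cvg_mxP {T : Type} {F : set_system T} {FF : Filter F} {m n : nat}
    {f : T -> 'M[R]_(m, n)} {l : 'M[R]_(m, n)} :
  f x @[x --> F] --> l <->
  forall i j, f x i j @[x --> F] --> l i j.
Proof.
split=> [fl i j|fl].
  apply/cvgrPdist_le => /= e e0; move/cvgrPdist_le : fl => /(_ _ e0).
  apply: filterS => x; apply: le_trans.
  rewrite [leRHS]/Num.Def.normr/= mx_normrE.
  by apply: le_trans (le_bigmax _ _ (i, j)); rewrite !mxE.
apply/cvgrPdist_le => /= e e0; near=> x.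
rewrite /Num.Def.normr/= mx_normrE (bigmax_le _ (ltW e0))//= => -[i j] _.
rewrite !mxE/=; move: i j; near: x.
apply: filter_forall => i; apply: filter_forall => j.
exact: ((cvgrPdist_le _ _).1 (fl i j)).
Unshelve. all: by end_near. Qed.

Lemma cvg_mulmx {T : Type} {F : set_system T} {FF : Filter F} {m n k : nat}
    {f : T -> 'M[R]_(m, n)} {g : T -> 'M[R]_(n, k)}
    {a : 'M[R]_(m, n)} {b : 'M[R]_(n, k)} :
  f x @[x --> F] --> a -> g x @[x --> F] --> b ->
  f x *m g x @[x --> F] --> a *m b.
Proof.
move=> /cvg_mxP fa /cvg_mxP gb; apply/cvg_mxP => i j.
under eq_fun do rewrite mxE; rewrite mxE.
apply: cvg_big => [|l _]; first exact: add_continuous.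
by apply: cvgM; [exact: fa|exact: gb].
Qed.

Lemma is_derive_mxP {m n : nat} {f : R -> 'M[R]_(m, n)} {t : R} {df} :
  is_derive t (1 : R) f df <->
  forall i j, is_derive t (1 : R) (fun x => f x i j) (df i j).
Proof.
split=> [[fd <-] i j|fd].
  have /derivable_mxP fdij := fd.
  by apply: DeriveDef; rewrite ?derive_mx// mxE.
have fd' : derivable f t 1 by apply/derivable_mxP => i j; have [] := fd i j.
apply: DeriveDef => //; rewrite derive_mx//; apply/matrixP => i j.
by rewrite mxE; have [] := fd i j.
Qed.

Lemma is_derive_mulmx {m n k : nat} {f : R -> 'M[R]_(m, n)}
    {g : R -> 'M[R]_(n, k)} {t : R} {df dg} :
  is_derive t (1 : R) f df -> is_derive t (1 : R) g dg ->
  is_derive t (1 : R) (fun x => f x *m g x) (df *m g t + f t *m dg).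
Proof.
move=> /is_derive_mxP fd /is_derive_mxP gd; apply/is_derive_mxP => i j.
have fgd l := is_deriveM (fd i l) (gd l j).
rewrite (_ : (fun x => _) = \sum_l (fun x => f x i l * g x l j)); last first.
  by apply/funext => x; rewrite mxE fct_sumE.
apply: is_derive_eq (is_derive_sum fgd) _.
rewrite !mxE -big_split/=; apply: eq_bigr => l _.
by rewrite addrC /GRing.scale/=; congr (_ + _); rewrite mulrC.
Qed.

Lemma is_derive_mulmxl {m n k : nat} (A : 'M[R]_(m, n))
    {f : R -> 'M[R]_(n, k)} {t : R} {df} :
  is_derive t (1 : R) f df -> is_derive t (1 : R) (fun x => A *m f x) (A *m df).
Proof.
move=> fd; have := is_derive_mulmx (f := fun=> A) (df := 0) _ fd.
by rewrite mul0mx add0r; apply; exact: is_derive_cst.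
Qed.

Lemma is_derive_trmx {m n : nat} {f : R -> 'M[R]_(m, n)} {t : R} {df} :
  is_derive t (1 : R) f df -> is_derive t (1 : R) (fun x => (f x)^T) df^T.
Proof.
move=> /is_derive_mxP fd; apply/is_derive_mxP => i j; rewrite mxE.
by under eq_fun do rewrite mxE; exact: fd.
Qed.

Lemma is_derive_dot {m n : nat} (A : 'M[R]_(m, n))
    {f : R -> 'M[R]_(m, n)} {t : R} {df} :
  is_derive t (1 : R) f df ->
  is_derive t (1 : R) (fun x => dot A (f x)) (dot A df).
Proof.
move=> /(is_derive_mulmxl A^T) /is_derive_mxP fd.
rewrite /euclidean_metric /mxtrace.
rewrite (_ : (fun x => _) = \sum_j (fun x => (A^T *m f x) j j)); last first.
  by apply/funext => x; rewrite fct_sumE.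
exact: is_derive_sum.
Qed.

(** The mean value theorem has no vector form with equality, so it is applied to the scalar function
    <Z, f> with Z = f 1 - f 0; Cauchy-Schwarz then gives |Z|^2 <= |Z| a. *)
Lemma frob_mvt {m n : nat} (f df : R -> 'M[R]_(m, n)) (a : R) :
  (forall t, is_derive t (1 : R) f (df t)) ->
  (forall t, 0 <= t <= 1 -> frob (df t) <= a) -> frob (f 1 - f 0) <= a.
Proof.
move=> fd dfa; set Z := f 1 - f 0.
have a0 : 0 <= a by apply: le_trans (frob_ge0 _) (dfa 0 _); rewrite lexx ler01.
have gd t := is_derive_dot Z (fd t).
have [|t tI] := MVT ltr01 (fun t _ => gd t).
  by apply: derivable_within_continuous => t _; have [] := gd t.
rewrite subr0 mulr1 -dotBr -/Z => ZE.
have : frob Z ^+ 2 <= frob Z * a.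
  rewrite sqr_frob ZE (le_trans (dot_cauchy_schwarz _ _))//.
  rewrite ler_wpM2l ?frob_ge0// dfa//.
  by move: tI; rewrite in_itv/= => /andP[/ltW-> /ltW->].
have [Z0|Z0 _] := ltP 0 (frob Z); first by rewrite expr2 ler_pM2l.
exact: le_trans Z0 a0.
Qed.

End MatrixCalculus.

(** * The matrix exponential and its restriction to skew matrices *)

Section MatrixExponential.
Context {R : realType}.
Local Open Scope classical_set_scope.

(** Crude bound, each product being a sum of p terms; it makes the real exponential series at p |A|
    a majorant of every entry of the matrix series. *)
Lemma coord_expr_le {p : nat} (A : 'M[R]_p) k i j :
  `|(A ^+ k) i j| <= (p%:R * frob A) ^+ k.
Proof.
elim: k i j => [|k IH] i j.
  by rewrite !expr0 mxE; case: eqP => _; rewrite ?normr1// normr0.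
rewrite exprS -mulmxE mxE (le_trans (ler_norm_sum _ _ _))//.
apply: (@le_trans _ _ (\sum_(l < p) frob A * (p%:R * frob A) ^+ k)).
  by apply: ler_sum => l _; rewrite normrM ler_pM ?coord_le_frob.
by rewrite sumr_const card_ord exprS -mulrA -[_ *+ p]mulr_natl.
Qed.

Lemma cvg_expmx {p : nat} (A : 'M[R]_p) :
  series (fun k => (k`!%:R)^-1 *: A ^+ k) @ \oo --> expmx A.
Proof.
suff cvgA i j : cvgn (series (fun k => (k`!%:R)^-1 * (A ^+ k) i j)).
  apply/cvg_ex; exists (\matrix_(i, j)
    limn (series (fun k => (k`!%:R)^-1 * (A ^+ k) i j))).
  apply/cvg_mxP => i j; rewrite mxE.
  rewrite (_ : (fun n => _) =
    series (fun k => (k`!%:R)^-1 * (A ^+ k) i j)); first exact: cvgA.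
  apply/funext => n; rewrite /series/= summxE.
  by apply: eq_bigr => k _; rewrite mxE.
apply: normed_cvg; set a := p%:R * frob A.
have a0 : 0 <= a by rewrite mulr_ge0 ?frob_ge0.
apply: series_le_cvg (is_cvg_series_exp_coeff a) => n //=.
  by rewrite exp_coeff_ge0.
by rewrite /exp_coeff/= normrM normfV normr_nat mulrC ler_wpM2r// coord_expr_le.
Qed.

(* 'M_p is not an algebra when p = 0 is allowed, so exprZn does not apply. *)
Lemma exprZmx {p : nat} (A : 'M[R]_p) (x : R) k :
  (x *: A) ^+ k = x ^+ k *: A ^+ k.
Proof.
elim: k => [|k IH]; first by rewrite !expr0 scale1r.
by rewrite !exprS IH -!mulmxE -scalemxAl -scalemxAr scalerA.
Qed.

(** The factor [B] makes this family of power series stable under termwise differentiation, which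
    replaces [B] by [A B]. *)
Lemma cvg_expmx_pseries {p : nat} (A B : 'M[R]_p) i j x :
  pseries (fun k => (k`!%:R)^-1 * (A ^+ k *m B) i j) x @ \oo -->
  (expmx (x *: A) *m B) i j.
Proof.
have cv := cvg_mulmx (cvg_expmx (x *: A)) (cvg_cst B).
have := cvg_mxP.1 (cv _ _) i j.
rewrite (_ : pseries _ x = fun n => (series (fun k =>
  (k`!%:R)^-1 *: (x *: A) ^+ k) n *m B) i j); first by apply.
apply/funext => n; rewrite /pseries /series/= mulmx_suml summxE.
by apply: eq_bigr => k _; rewrite exprZmx -!scalemxAl !mxE; ring.
Qed.

Lemma is_derive_expmx {p : nat} (A : 'M[R]_p) s :
  is_derive s (1 : R) (fun s => expmx (s *: A)) (expmx (s *: A) *m A).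
Proof.
apply/is_derive_mxP => i j.
pose c B k : R := (k`!%:R)^-1 * (A ^+ k *m B) i j.
have limE x B : (expmx (x *: A) *m B) i j = limn (pseries (c B) x).
  exact/esym/cvg_lim/cvg_expmx_pseries.
have diffsE B : pseries_diffs (c B) = c (A *m B).
  apply/funext => k; rewrite /pseries_diffs /c factS natrM invfM exprSr.
  by rewrite -mulmxE -mulmxA -mulrA mulVKf.
have cvgc B x : cvgn (pseries (c B) x).
  by apply/cvg_ex; eexists; exact: cvg_expmx_pseries.
have -> : (fun x => expmx (x *: A) i j) = fun x => limn (pseries (c 1%:M) x).
  by apply/funext => x; rewrite -(limE x 1%:M) mulmx1.
have -> : (expmx (s *: A) *m A) i j =
    limn (pseries (pseries_diffs (c 1%:M)) s).
  by rewrite diffsE mulmx1; exact: limE.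
(* Any radius larger than |s| would do, the series converging everywhere. *)
apply: (@pseries_snd_diffs _ _ (`|s| + 1)); rewrite ?diffsE//.
by rewrite [ltRHS]ger0_norm ?ltrDl// addr_ge0.
Qed.

Lemma expmx0 {p : nat} : expmx (0 : 'M[R]_p) = 1%:M.
Proof.
(* The empty partial sum is 0; the sums are constant only from index 1 on. *)
have sum1 n : series (fun k => (k`!%:R)^-1 *: (0 : 'M[R]_p) ^+ k) n.+1 = 1%:M.
  rewrite /series/= big_nat_recl//= expr0 fact0 invr1 scale1r.
  by rewrite big1 ?addr0// => k _; rewrite exprS mul0r scaler0.
have := cvg_expmx (0 : 'M[R]_p); rewrite -cvg_shiftS.
by under eq_fun do rewrite sum1; move/(cvg_unique _)/(_ (cvg_cst _)); exact.
Qed.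

(** With E = exp (s A), the product E E^T has derivative E (A + A^T) E^T = 0, so it keeps its value
    1 at s = 0. *)
Lemma skew_expmx_orth {p : nat} (A : 'M[R]_p) :
  A^T = - A -> expmx A *m (expmx A)^T = 1%:M.
Proof.
move=> AT; pose F s := expmx (s *: A) *m (expmx (s *: A))^T.
have Fd s : is_derive s (1 : R) F 0.
  have := is_derive_mulmx (is_derive_expmx A s)
    (is_derive_trmx (is_derive_expmx A s)).
  move/is_derive_eq; apply.
  by rewrite trmx_mul AT !mulmxA mulmxN mulNmx subrr.
have := frob_mvt F (fun=> 0) 0 Fd; rewrite /F scale1r scale0r expmx0.
rewrite trmx1 mulmx1 => h.
by apply/subr0_eq/frob_le0/h => t _; rewrite frob0.
Qed.

(* The curve s |-> exp (s A) exp (s B)^T has speed |A - B|. *)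
Lemma skew_expmx_lipschitz {p : nat} (A B : 'M[R]_p) :
  A^T = - A -> B^T = - B -> frob (expmx A - expmx B) <= frob (A - B).
Proof.
move=> AT BT.
have skewZ (C : 'M[R]_p) t : C^T = - C -> (t *: C)^T = - (t *: C).
  by move=> CT; rewrite linearZ/= CT scalerN.
have BB := skew_expmx_orth _ BT.
pose F s := expmx (s *: A) *m (expmx (s *: B))^T.
have Fd s : is_derive s (1 : R) F
    (expmx (s *: A) *m (A - B) *m (expmx (s *: B))^T).
  have := is_derive_mulmx (is_derive_expmx A s)
    (is_derive_trmx (is_derive_expmx B s)).
  move/is_derive_eq; apply.
  by rewrite trmx_mul BT mulNmx mulmxN mulmxBr mulmxBl !mulmxA.
have := frob_mvt F _ (frob (A - B)) Fd; rewrite /F !scale1r !scale0r !expmx0.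
(* Writing 1 as exp B (exp B)^T turns the difference of the end points into (exp A - exp B) (exp
   B)^T, of the same norm as exp A - exp B. *)
rewrite trmx1 mulmx1 -BB -mulmxBl frob_mulmx_orthr; last first.
  by rewrite trmxK; exact: mulmx1C.
apply=> t _; rewrite frob_mulmx_orthr; last first.
  by rewrite trmxK; apply/mulmx1C/skew_expmx_orth/skewZ.
by rewrite frob_mulmx_orthl//; apply/mulmx1C/skew_expmx_orth/skewZ.
Qed.

End MatrixExponential.

(** * Existence of a positive semidefinite square root of 1 + N *)

Section PsdSquareRoot.
Context {R : realType}.
Local Open Scope classical_set_scope.

Lemma psdmxP {p : nat} (S : 'M[R]_p) :
  S^T = S -> (forall x : 'cV[R]_p, 0 <= dot x (S *m x)) -> psdmx S.
Proof.
move=> ST S0; split=> // x; have := S0 x.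
by rewrite /euclidean_metric /mxtrace big_ord1 mulmxA.
Qed.

(** Cauchy-Schwarz for the form K, applied to X and K X: |K X|^4 <= <X, K X> <K X, K K X> <= a |X|^2
    a |K X|^2. *)
Lemma psd_contraction {p : nat} (K : 'M[R]_p) (a : R) :
  psdmx K -> 0 <= a ->
  (forall k (X : 'M[R]_(p, k)), dot X (K *m X) <= a * dot X X) ->
  forall k (X : 'M[R]_(p, k)), frob (K *m X) <= a * frob X.
Proof.
move=> Kp a0 Ka k X; have [KT _] := Kp.
rewrite frob_le ?mulr_ge0 ?frob_ge0// exprMn sqr_frob.
have := psd_cauchy_schwarz X (K *m X) Kp.
rewrite (_ : dot X (K *m (K *m X)) = dot (K *m X) (K *m X)); last first.
  by rewrite [RHS]dot_mulmxl KT.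
have := Ka _ X; have := Ka _ (K *m X); have := psd_dot X Kp.
have := dot_ge0 (K *m X); have := psd_dot (K *m X) Kp; have := dot_ge0 X.
move: (dot (K *m X) (K *m X)) (dot X (K *m X)) (dot X X).
move=> e q x x0 r0 e0 q0 r_le q_le e2.
have [e_gt0|e_le0] := ltP 0 e; last first.
  by rewrite (le_trans e_le0)// mulr_ge0// sqr_ge0.
rewrite -(ler_pM2l e_gt0) -expr2 (le_trans e2)//.
rewrite (le_trans (ler_pM _ _ q_le r_le))//.
by rewrite (_ : a * x * _ = e * (a ^+ 2 * x))//; ring.
Qed.

(** The equation (1 - Y)^2 = 1 - K, solved for the linear term in Y. *)
Definition sqrt_step {p : nat} (K Y : 'M[R]_p) : 'M[R]_p :=
  2^-1 *: (K + Y *m Y).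

(* The fixed point of sqrt_step K is 1 - (1 - K)^(1/2); the iterates converge
   geometrically because K, hence each of them, contracts by the factor a. *)
Lemma sqrt_step_fixpoint {p : nat} (K : 'M[R]_p) (a : R) :
  K^T = K -> 0 <= a < 1 ->
  (forall k (X : 'M[R]_(p, k)), frob (K *m X) <= a * frob X) ->
  exists L : 'M[R]_p, [/\ L^T = L, sqrt_step K L = L &
    forall x : 'cV[R]_p, dot x (L *m x) <= dot x x].
Proof.
move=> KT /andP[a0 a1] Ka; pose Y n := iter n (sqrt_step K) 0.
have YS n : Y n.+1 = sqrt_step K (Y n) by [].
have YT n : (Y n)^T = Y n.
  elim: n => [|n IH]; first exact: trmx0.
  by rewrite YS /sqrt_step linearZ/= linearD/= trmx_mul KT IH.
(* Invariant of the iteration: (a + a^2) / 2 <= a because a < 1. *)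
have Ya n k (X : 'M[R]_(p, k)) : frob (Y n *m X) <= a * frob X.
  elim: n => [|n IH] in k X *.
    by rewrite mul0mx frob0 mulr_ge0 ?frob_ge0.
  rewrite YS /sqrt_step -scalemxAl mulmxDl -mulmxA frobZ ger0_norm ?invr_ge0//.
  have h1 := frob_triangle (K *m X) (Y n *m (Y n *m X)).
  have h2 := Ka _ X; have h3 := IH _ (Y n *m X); have h4 := IH _ X.
  have h5 := ler_wpM2l a0 h4; have h6 := frob_ge0 X.
  have h7 : a * (a * frob X) <= a * frob X.
    by rewrite ler_wpM2l// ler_piMl// ltW.
  rewrite mulrC ler_pdivrMr//; lra.
have Yr n k (X : 'M[R]_(k, p)) : frob (X *m Y n) <= a * frob X.
  by rewrite -(frob_trmx (X *m _)) trmx_mul YT -(frob_trmx X) Ya.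
have YD n : frob (Y n.+1 - Y n) <= frob (Y 1%N - Y 0%N) * a ^+ n.
  elim: n => [|n IH]; first by rewrite expr0 mulr1.
  (* A difference of squares factored without assuming that the iterates commute; each of the two
     halves contracts by [a]. *)
  have -> : Y n.+2 - Y n.+1 =
      2^-1 *: (Y n.+1 *m (Y n.+1 - Y n) + (Y n.+1 - Y n) *m Y n).
    rewrite [in LHS]YS [Y n.+1 in X in _ - X]YS /sqrt_step -scalerBr.
    by rewrite opprD addrACA subrr add0r mulmxBr mulmxBl addrA subrK.
  rewrite frobZ ger0_norm ?invr_ge0// exprS mulrCA mulrC ler_pdivrMr//.
  apply: (le_trans (frob_triangle _ _)).
  have h1 := Ya n.+1 _ (Y n.+1 - Y n); have h2 := Yr n _ (Y n.+1 - Y n).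
  have := ler_wpM2l a0 IH; lra.
have Ycvg : cvgn Y.
  suff Yij i j : cvgn (fun n => Y n i j).
    apply/cvg_ex; exists (\matrix_(i, j) limn (fun n => Y n i j)).
    by apply/cvg_mxP => i j; rewrite mxE; exact: Yij.
  have -> : (fun n => Y n i j) = series (fun n => (Y n.+1 - Y n) i j).
    apply/funext => n; rewrite /series/= -summxE telescope_sumr//.
    by rewrite subr0.
  apply: normed_cvg.
  apply: series_le_cvg (@is_cvg_geometric_series _ (frob (Y 1%N - Y 0%N)) a _).
  - by move=> n /=.
  - by move=> n /=; rewrite mulr_ge0 ?frob_ge0 ?exprn_ge0.
  - by move=> n /=; exact: le_trans (coord_le_frob _ _ _) (YD n).
  - by rewrite ger0_norm.
set L := limn Y; have YL : Y @ \oo --> L by exact: Ycvg.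
exists L; split.
- apply/matrixP => i j; rewrite mxE.
  apply: (cvg_unique _ (cvg_mxP.1 YL j i)) => //.
  rewrite (_ : (fun n => _) = fun n => Y n i j); first exact: cvg_mxP.1 YL i j.
  by apply/funext => n; rewrite -{1}(YT n) mxE.
- have YSL : Y n.+1 @[n --> \oo] --> L by rewrite cvg_shiftS.
  have : Y n.+1 @[n --> \oo] --> sqrt_step K L.
    by apply: cvgZl_tmp; apply: cvgD; [exact: cvg_cst|exact: cvg_mulmx].
  by move/(cvg_unique _)/(_ YSL); apply.
- move=> x; rewrite -subr_ge0.
  have cv : (fun n => (x^T *m (1%:M - Y n) *m x) 0 0) @ \oo -->
      (x^T *m (1%:M - L) *m x) 0 0.
    apply: (cvg_mxP.1 _ 0 0); apply: cvg_mulmx; last exact: cvg_cst.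
    apply: cvg_mulmx; first exact: cvg_cst.
    by apply: cvgB; first exact: cvg_cst.
  have dotx Z : (x^T *m (1%:M - Z) *m x) 0 0 = dot x x - dot x (Z *m x).
    rewrite -dotBr /euclidean_metric /mxtrace big_ord1 -mulmxA.
    by rewrite mulmxBl mul1mx.
  rewrite -dotx; apply: (cvgr_to_ge cv); apply: nearW => n.
  rewrite dotx subr_ge0.
  rewrite (le_trans (dot_cauchy_schwarz _ _))// -sqr_frob expr2.
  rewrite ler_wpM2l ?frob_ge0// (le_trans (Ya _ _ _))//.
  by rewrite ler_piMl ?frob_ge0// ltW.
Qed.

(** With b = |N| and c = 1 + b, one has 1 + N = c (1 - K) for K = (b - N) / c, and 0 <= K <= b / c <
    1 puts K within reach of the iteration. The root is c^(1/2) (1 - L), [L] being the fixed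
    point. *)
Lemma psd_sqrt_exists {p : nat} (N : 'M[R]_p) :
  psdmx N -> exists S, psdmx S /\ S *m S = 1%:M + N.
Proof.
move=> Np; have [NT _] := Np; set b := frob N; have b0 : 0 <= b := frob_ge0 N.
have Nb k (X : 'M[R]_(p, k)) : dot X (N *m X) <= b * dot X X.
  rewrite (le_trans (dot_cauchy_schwarz _ _))// -sqr_frob expr2 mulrCA.
  by rewrite ler_wpM2l ?frob_ge0// frob_mulmx.
set c := 1 + b; have c0 : 0 < c by rewrite ltr_pwDl.
pose K := c^-1 *: (b%:M - N).
have KE k (X : 'M[R]_(p, k)) :
    dot X (K *m X) = c^-1 * (b * dot X X - dot X (N *m X)).
  by rewrite /K -scalemxAl mulmxBl mul_scalar_mx dotZr dotBr dotZr.
have KT : K^T = K by rewrite /K linearZ/= linearB/= tr_scalar_mx NT.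
have Kp : psdmx K.
  apply: psdmxP => // x.
  by rewrite KE mulr_ge0 ?invr_ge0 ?(ltW c0)// subr_ge0.
have bc0 : 0 <= b / c by rewrite divr_ge0 ?(ltW c0).
have bc1 : 0 <= b / c < 1 by rewrite bc0/= ltr_pdivrMr// mul1r /c ltrDr.
have Kbc k (X : 'M[R]_(p, k)) : dot X (K *m X) <= b / c * dot X X.
  rewrite KE [leRHS]mulrAC mulrC ler_wpM2r ?invr_ge0 ?(ltW c0)//.
  by rewrite lerBlDr lerDl psd_dot.
have [L [LT LK L1]] :=
  sqrt_step_fixpoint K _ KT bc1 (psd_contraction K _ Kp bc0 Kbc).
pose S := Num.sqrt c *: (1%:M - L); exists S; split.
  apply: psdmxP => [|x]; first by rewrite /S linearZ/= linearB/= trmx1 LT.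
  rewrite /S -scalemxAl mulmxBl mul1mx dotZr dotBr.
  by rewrite mulr_ge0 ?sqrtr_ge0// subr_ge0.
rewrite /S -scalemxAl -scalemxAr scalerA -expr2 sqr_sqrtr ?(ltW c0)//.
rewrite mulmxBl !mulmxBr !mulmx1 mul1mx.
have LL : L *m L = 2 *: L - K.
  by rewrite -[in 2 *: L]LK /sqrt_step scalerA mulfV// scale1r addrC addKr.
have cK : c *: K = b%:M - N by rewrite /K scalerA mulfV ?gt_eqF// scale1r.
have -> : N = b%:M - c *: K by rewrite cK opprB addrCA subrr addr0.
rewrite LL; apply/matrixP => i j; rewrite !mxE /c.
by case: eqP => _ /=; ring.
Qed.

End PsdSquareRoot.

(** * Resolvent of a skew matrix *)

Section CayleyCurve.
Context {R : realType}.
Local Open Scope classical_set_scope.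

Definition resolvent {m : nat} (Z : 'M[R]_m) (t : R) : 'M[R]_m :=
  invmx (1%:M - t *: Z).

Lemma skew_dot {m k : nat} (Z : 'M[R]_m) (X : 'M[R]_(m, k)) :
  Z^T = - Z -> dot X (Z *m X) = 0.
Proof.
move=> ZT; have : dot X (Z *m X) = - dot X (Z *m X).
  by rewrite {1}dotC dot_mulmxl ZT mulNmx dotNr.
lra.
Qed.

(** The cross term vanishes by skewness: |(1 - t Z) X|^2 = |X|^2 + t^2 |Z X|^2. Both invertibility
    and contraction of the resolvent follow. *)
Lemma dot_skew_resolvent {m k : nat} (Z : 'M[R]_m) t
    (X : 'M[R]_(m, k)) :
  Z^T = - Z -> dot X X <= dot ((1%:M - t *: Z) *m X) ((1%:M - t *: Z) *m X).
Proof.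
move=> ZT; rewrite mulmxBl mul1mx -scalemxAl !(dotBl, dotBr, dotZl, dotZr).
rewrite (dotC (Z *m X) X) skew_dot//.
have := mulr_ge0 (sqr_ge0 t) (dot_ge0 (Z *m X)); lra.
Qed.

Lemma skew_resolvent_unit {m : nat} (Z : 'M[R]_m) (t : R) :
  Z^T = - Z -> 1%:M - t *: Z \in unitmx.
Proof.
move=> ZT; apply: inj_col_unitmx => x x0; apply/frob_le0.
by have := frob_le_of_sqr _ _ (dot_skew_resolvent _ t x ZT); rewrite x0 frob0.
Qed.

Lemma skew_resolvent_contraction {m k : nat} (Z : 'M[R]_m) t
    (X : 'M[R]_(m, k)) :
  Z^T = - Z -> frob (resolvent Z t *m X) <= frob X.
Proof.
move=> ZT.
have := frob_le_of_sqr _ _ (dot_skew_resolvent Z t (resolvent Z t *m X) ZT).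
by rewrite mulmxA mulmxV ?mul1mx// skew_resolvent_unit.
Qed.

Lemma resolventC {m : nat} (Z : 'M[R]_m) (t : R) :
  Z^T = - Z -> resolvent Z t *m Z = Z *m resolvent Z t.
Proof.
move=> ZT; have Zu := skew_resolvent_unit Z t ZT.
have comm : Z *m (1%:M - t *: Z) = (1%:M - t *: Z) *m Z.
  by rewrite mulmxBr mulmxBl mulmx1 mul1mx -scalemxAl -scalemxAr.
rewrite -[LHS]mulmx1 -(mulmxV Zu) mulmxA; congr (_ *m _).
by rewrite -mulmxA comm mulmxA mulVmx// mul1mx.
Qed.

(** First resolvent identity. It gives the continuity of the resolvent, by contraction uniformly in
    s, and then its derivative, as the quotient by s - t is a product of continuous factors. *)
Lemma resolventB {m : nat} (Z : 'M[R]_m) s t :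
  Z^T = - Z ->
  resolvent Z s - resolvent Z t =
  (s - t) *: (resolvent Z s *m Z *m resolvent Z t).
Proof.
move=> ZT.
have E : (s - t) *: Z = (1%:M - t *: Z) - (1%:M - s *: Z).
  by apply/matrixP => i j; rewrite !mxE; ring.
rewrite scalemxAl scalemxAr E mulmxBr mulmxBl.
rewrite mulVmx ?skew_resolvent_unit// mul1mx -mulmxA mulmxV ?mulmx1//.
exact: skew_resolvent_unit.
Qed.

Lemma continuous_resolvent {m : nat} (Z : 'M[R]_m) :
  Z^T = - Z -> continuous (resolvent Z).
Proof.
move=> ZT t; apply/cvg_mxP => i j; apply/cvgrPdist_le => e e0.
(* The added 1 keeps [C] positive, so that [e] can be divided by it. *)
set C := frob (Z *m resolvent Z t) + 1.
have C0 : 0 < C by rewrite ltr_wpDl ?frob_ge0.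
near=> s; rewrite distrC.
have -> : resolvent Z s i j - resolvent Z t i j =
    ((s - t) *: (resolvent Z s *m (Z *m resolvent Z t))) i j.
  by rewrite mulmxA -resolventB// !mxE.
rewrite (le_trans (coord_le_frob _ _ _))// frobZ.
apply: (@le_trans _ _ (`|s - t| * C)).
  rewrite ler_wpM2l// (le_trans (skew_resolvent_contraction _ _ _ ZT))//.
  by rewrite /C lerDl.
rewrite -ler_pdivlMr// distrC; near: s.
by apply: cvgr_dist_le; rewrite ?divr_gt0//; exact: cvg_id.
Unshelve. all: by end_near. Qed.

Lemma is_derive_resolvent {m : nat} (Z : 'M[R]_m) (t : R) :
  Z^T = - Z ->
  is_derive t (1 : R) (resolvent Z) (resolvent Z t *m Z *m resolvent Z t).
Proof.
move=> ZT.
have lim_quot : h^-1 *: (resolvent Z (h *: 1 + t) - resolvent Z t)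
    @[h --> (0 : R)^'] --> resolvent Z t *m Z *m resolvent Z t.
  have cvgR : resolvent Z (h *: 1 + t) @[h --> (0 : R)^'] --> resolvent Z t.
    have shift0 : h *: (1 : R) + t @[h --> (0 : R)^'] --> t.
      rewrite -[X in _ --> X]add0r; apply: cvgD; last exact: cvg_cst.
      rewrite -[X in _ --> X](scale0r (1 : R)); apply: cvgZr_tmp.
      exact: cvg_within.
    exact: cvg_comp shift0 (continuous_resolvent Z ZT t).
  apply: cvg_trans
    (cvg_mulmx (cvg_mulmx cvgR (cvg_cst Z)) (cvg_cst (resolvent Z t))).
  apply: near_eq_cvg; near=> h.
  have h1 : h *: (1 : R) = h by rewrite /GRing.scale/= mulr1.
  rewrite resolventB// addrK scalerA h1 mulVf ?scale1r//.
  by near: h; exact: nbhs_dnbhs_neq.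
apply: DeriveDef; first by apply/cvg_ex; eexists; exact: lim_quot.
exact: cvg_lim lim_quot.
Unshelve. all: by end_near. Qed.

End CayleyCurve.

(** * Length of the Cayley curve *)

Section CayleyDistance.
Context {R : realType}.
Local Open Scope classical_set_scope.

Lemma curve_length_le {m p : nat} (c dc : R -> 'M[R]_(m, p)) (a : R) :
  (forall t, is_derive t (1 : R) c (dc t)) -> continuous dc ->
  (forall t, t \in `[0, 1]%R -> frob (dc t) <= a) ->
  (curve_length c <= a%:E)%E.
Proof.
move=> cd dc_cont dca.
have dcE : derive1 c = dc.
  by apply/funext => t; rewrite derive1E; have [_ ->] := cd t.
(* Continuity makes the speed measurable, as the comparison of integrals requires. *)
have frob_cont : continuous (fun t => frob (dc t)).
  move=> t; under eq_fun do rewrite frobE dotE.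
  apply: continuous_cvg; first exact: sqrt_continuous.
  apply: cvg_big => [|i _]; first exact: add_continuous.
  apply: cvg_big => [|j _]; first exact: add_continuous.
  by apply: cvgM; exact: (cvg_mxP.1 (dc_cont t) i j).
rewrite /curve_length dcE; under eq_integral do rewrite -frobE.
apply: (@le_trans _ _ (\int[lebesgue_measure]_(t in `[0%R, 1%R]) a%:E)%E).
  apply: ge0_le_integral => //=.
  - by move=> t _; rewrite lee_fin frob_ge0.
  - apply/measurable_EFinP; apply: measurable_funTS.
    exact: continuous_measurable_fun.
rewrite -[X in integral _ _ X]/(cst a%:E) integral_cst//=.
by rewrite lebesgue_measure_itv/= lte01 oppr0 adde0 mule1.
Qed.

(** A U U^T has the norm of A U, since U^T U = 1, and <A, A U U^T> = |A U|^2; Cauchy-Schwarz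
    concludes. *)
Lemma frob_mulmx_stiefel {k m p : nat} (A : 'M[R]_(k, m)) (U : 'M[R]_(m, p)) :
  stiefel U -> frob (A *m U) <= frob A.
Proof.
rewrite /stiefel/= => UU.
have := dot_cauchy_schwarz A (A *m U *m U^T).
rewrite (frob_mulmx_orthr _ U^T) ?trmxK// (dotC A) dot_mulmxr trmxK.
rewrite -sqr_frob expr2; have [U0|U0 _] := ltP 0 (frob (A *m U)).
  by rewrite ler_pM2r.
exact: le_trans U0 (frob_ge0 _).
Qed.

(* The curve is t |-> (1 - t Z)^-1 (1 + t Z) U with Z = W / 2, written with
   (1 - t Z)^-1 (1 + t Z) = 2 (1 - t Z)^-1 - 1. *)
Lemma stiefel_dist_cayley {m p : nat} (U V : 'M[R]_(m, p)) (W : 'M[R]_m) :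
  stiefel U -> W^T = - W -> W *m (U + V) = 2 *: (V - U) ->
  (stiefel_dist U V <= (frob W)%:E)%E.
Proof.
move=> Us WT WUV; pose Z := 2^-1 *: W.
have ZT : Z^T = - Z by rewrite /Z linearZ/= WT scalerN.
pose Q t := 2 *: resolvent Z t - 1%:M.
pose c t := Q t *m U.
pose dc t := 2 *: (resolvent Z t *m Z *m resolvent Z t) *m U.
have cd t : is_derive t (1 : R) c (dc t).
  have := is_derive_mulmx
    (is_deriveB (is_deriveZ 2 (is_derive_resolvent Z t ZT))
      (is_derive_cst (1%:M : 'M[R]_m) t 1)) (is_derive_cst U t 1).
  by move/is_derive_eq; apply; rewrite mulmx0 addr0 subr0.
have Rcont := continuous_resolvent Z ZT.
have dc_cont : continuous dc.
  move=> t; apply: cvg_mulmx; last exact: cvg_cst.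
  apply: cvgZl_tmp; apply: cvg_mulmx; last exact: Rcont.
  by apply: cvg_mulmx; [exact: Rcont|exact: cvg_cst].
have RK t : resolvent Z t *m (1%:M - t *: Z) = 1%:M.
  by rewrite mulVmx// skew_resolvent_unit.
have KR t : (1%:M - t *: Z) *m resolvent Z t = 1%:M by exact: mulmx1C.
have QE t : Q t = resolvent Z t *m (1%:M + t *: Z).
  have -> : 1%:M + t *: Z = 2%:R%:M - (1%:M - t *: Z).
    by apply/matrixP => i j; rewrite !mxE; case: eqP => _ /=; ring.
  by rewrite mulmxBr RK mul_mx_scalar.
(* Both orders of the factors are needed: since 1 + t Z is the transpose of 1 - t Z, using one order
   in each factor of [Q^T Q] makes the resolvents cancel. *)
have QE' t : Q t = (1%:M + t *: Z) *m resolvent Z t.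
  have -> : 1%:M + t *: Z = 2%:R%:M - (1%:M - t *: Z).
    by apply/matrixP => i j; rewrite !mxE; case: eqP => _ /=; ring.
  by rewrite mulmxBl KR mul_scalar_mx.
have KT t : (1%:M - t *: Z)^T = 1%:M + t *: Z.
  by rewrite linearB/= trmx1 linearZ/= ZT scalerN opprK.
have QQ t : (Q t)^T *m Q t = 1%:M.
  rewrite {1}QE' -KT trmx_mul trmxK QE mulmxA -(mulmxA _^T) KR mulmx1.
  by rewrite -KT -trmx_mul KR trmx1.
have c0 : c 0 = U.
  rewrite /c /Q /resolvent scale0r subr0 invmx1 scaler_nat mulr2n addrK.
  exact: mul1mx.
have c1 : c 1 = V.
  (* The equation Z (U + V) = V - U is (1 + Z) U = (1 - Z) V rearranged. *)
  rewrite /c QE -mulmxA (_ : _ *m U = (1%:M - 1 *: Z) *m V).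
    by rewrite mulmxA RK mul1mx.
  have ZUV : Z *m U = V - U - Z *m V.
    have <- : Z *m (U + V) = V - U.
      by rewrite /Z -scalemxAl WUV scalerA mulVf// scale1r.
    by rewrite mulmxDr addrK.
  rewrite scale1r !mulmxDl mulNmx !mul1mx ZUV.
  by rewrite addrA addrCA subrr addr0.
apply: (@le_trans _ _ (curve_length c)).
  apply: ereal_inf_lbound; exists c => //=; split=> //.
  - exists [::]; split; first by rewrite /= ltr01.
    move=> i; rewrite leqn0 => /eqP->; exists c; split=> //; split.
      by move=> t; have [] := cd t.
    suff -> : derive1 c = dc by [].
    by apply/funext => t; rewrite derive1E; have [_ ->] := cd t.
  - move=> t _; rewrite /stiefel/= /c trmx_mul mulmxA -(mulmxA U^T) QQ.
    by rewrite mulmx1.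
apply: (curve_length_le c dc _ cd dc_cont) => t _.
(* Commuting Z past the right resolvent leaves 2 R R Z with R a contraction, so the speed is at most
   2 |Z| = |W|. *)
rewrite (le_trans (frob_mulmx_stiefel _ _ Us))// -mulmxA -resolventC// frobZ.
have -> : W = 2 *: Z by rewrite /Z scalerA mulfV// scale1r.
rewrite frobZ ler_wpM2l//.
by do 2![rewrite (le_trans (skew_resolvent_contraction _ _ _ ZT))//].
Qed.

End CayleyDistance.

(** * Lipschitz bound for the parametrization, and the conclusion *)

Section PolarLight.
Context {R : realType}.

(** The derivative (1 - y^2)^(-1/2) is at least 1; the mean value theorem needs a nondegenerate
    interval, so x = 0 is treated apart. *)
Lemma le_asin (x : R) : 0 <= x < 1 -> x <= asin x.
Proof.
have asin0 : asin (0 : R) = 0.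
  rewrite -[X in asin X]sin0 sinK// in_itv/= oppr_le0 andbb.
  by rewrite divr_ge0 ?pi_ge0.
move=> /andP[x0 x1]; have [x_gt0|x_le0] := ltP 0 x; last first.
  have -> : x = 0 by apply/eqP; rewrite eq_le x_le0 x0.
  by rewrite asin0.
have dom y : 0 <= y <= x -> -1 < y < 1.
  by move=> /andP[y0 yx]; rewrite (le_lt_trans yx x1) andbT (lt_le_trans _ y0).
have [| |y yI] := MVT (f := asin) 
  (df := fun y => (Num.sqrt (1 - y ^+ 2))^-1) x_gt0.
- move=> y; rewrite in_itv/= => /andP[/ltW y0 /ltW yx].
  by apply/is_derive1_asin/dom; rewrite y0.
- apply: derivable_within_continuous => y.
  by rewrite in_itv/= => /dom/is_derive1_asin[].
have : 0 <= y <= x by move: yI; rewrite in_itv/= => /andP[/ltW-> /ltW->].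
move=> /dom/andP[yN1 y1].
have y2 : y ^+ 2 < 1 by rewrite expr2; nra.
rewrite asin0 !subr0 => ->; rewrite ler_peMl// invf_ge1 ?sqrtr_gt0 ?subr_gt0//.
by rewrite -[leRHS]sqrtr1 ler_sqrt// gerBl sqr_ge0.
Qed.

Lemma psd_gram {m p : nat} (B : 'M[R]_(m, p)) : psdmx (B^T *m B).
Proof.
apply: psdmxP => [|x]; first by rewrite trmx_mul trmxK.
by rewrite -mulmxA -[X in dot x X]/(_ *m _) -[B]trmxK -dot_mulmxl trmxK dot_ge0.
Qed.

Lemma dot_col_mx {m1 m2 p : nat} (A1 A2 : 'M[R]_(m1, p))
    (B1 B2 : 'M[R]_(m2, p)) :
  dot (col_mx A1 B1) (col_mx A2 B2) = dot A1 A2 + dot B1 B2.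
Proof. by rewrite /euclidean_metric tr_col_mx mul_row_col mxtraceD. Qed.

(* The polar decomposition of the matrix with blocks exp A and B, whose Gram
   matrix is 1 + B^T B. *)
Lemma polar_light_decomposition {p q : nat} (X : 'M[R]_(p + q, p)) :
  skew_stack X -> exists S : 'M[R]_p, [/\ stiefel (polar_light X),
    psdmx (S - 1%:M) &
    polar_light X *m S = col_mx (expmx (usubmx X)) (dsubmx X)].
Proof.
rewrite /skew_stack/= => XT; set W := col_mx _ _; set B := dsubmx X.
(* Existence of the root ensures that [xget] does not return its default value. *)
have [Sp SS] : psdmx (sqrtmx (1%:M + B^T *m B)) /\
    sqrtmx (1%:M + B^T *m B) *m sqrtmx (1%:M + B^T *m B) = 1%:M + B^T *m B.
  by rewrite /sqrtmx; apply: (xgetPex 0 (psd_sqrt_exists _ (psd_gram B))).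
have [ST _] := Sp; have [Su S1] := psd_sqr_ge1 _ _ Sp (psd_gram B) SS.
set S := sqrtmx _ in Sp SS ST Su S1.
have WW : W^T *m W = S *m S.
  by rewrite /W tr_col_mx mul_row_col SS (mulmx1C (skew_expmx_orth _ XT)).
exists S; split; rewrite ?/polar_light -/B -/S -/W.
- rewrite /stiefel/= trmx_mul trmx_inv ST mulmxA -(mulmxA _ W^T) WW.
  by rewrite mulmxA mulVmx// mul1mx mulmxV.
- apply: psdmxP => [|x]; first by rewrite linearB/= trmx1 ST.
  by rewrite mulmxBl mul1mx dotBr subr_ge0.
- by rewrite -mulmxA mulVmx// mulmx1.
Qed.

Lemma polar_light_lipschitz {p q : nat} (X Y : 'M[R]_(p + q, p)) :
  skew_stack X -> skew_stack Y ->
  frob (polar_light Y - polar_light X) <= frob (X - Y).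
Proof.
move=> Xs Ys; have [SX [XX PX EX]] := polar_light_decomposition X Xs.
have [SY [YY PY EY]] := polar_light_decomposition Y Ys.
rewrite (le_trans (polar_factor_lipschitz _ _ SX SY XX YY PX PY))// EX EY.
rewrite opp_col_mx add_col_mx -(frobN (X - Y)) opprB.
rewrite -[X in _ <= frob (_ - X)]vsubmxK.
rewrite -[X in _ <= frob (X - _)]vsubmxK opp_col_mx add_col_mx.
(* The lower blocks contribute the same term to both sides; only the exponentials of the upper
   blocks remain to be compared. *)
apply: frob_le_of_sqr; rewrite !dot_col_mx lerD2r -!sqr_frob.
rewrite ler_sqr ?nnegrE ?frob_ge0//; exact: skew_expmx_lipschitz.
Qed.

End PolarLight.

Theorem theorem3p6 (R : realType) (n p : nat) (hp : (0 < p)%N)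
  (hpn : (p <= n)%N) (X Y : 'M[R]_(p + (n - p), p))
  (hX : skew_stack X) (hY : skew_stack Y)
  (hXY : frobenius_norm (X - Y) < 2 / 3) :
  (stiefel_dist (polar_light X) (polar_light Y)
     <= (2 * asin (3 / 2 * frobenius_norm (X - Y)))%:E)%E.
Proof.
have lip := polar_light_lipschitz X Y hX hY.
have [SX [XX _ _]] := polar_light_decomposition X hX.
have [SY [YY _ _]] := polar_light_decomposition Y hY.
(* The Lipschitz bound carries the threshold 2/3 from the parameters to the points; the same
   threshold puts 3 d / 2 below 1, as [le_asin] requires. *)
have [W [WT WUV W_le]] := cayley_generator _ _ XX YY (le_lt_trans lip hXY).
apply: (le_trans (stiefel_dist_cayley _ _ _ XX WT WUV)); rewrite lee_fin.
have d0 := frob_ge0 (X - Y).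
have := le_asin (3 / 2 * frob (X - Y)) _.
have -> : 0 <= 3 / 2 * frob (X - Y) < 1 by apply/andP; split; lra.
by move=> /(_ isT); lra.
Qed.
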